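(* Let $G^\sigma$ be a connected oriented unicyclic graph of order $n$ whose unique cycle $C_k^\sigma$ has length $k$, and assume $sr(G^\sigma)=k$ if $k$ is even and $sr(G^\sigma)=k+1$ if $k$ is odd. (1) If there exists a vertex $v\in V(C_k^\sigma)$ which is saturated in $G^\sigma\{v\}$, then $G^\sigma\{v\}$ is an oriented star and $\beta(G^\sigma-G^\sigma\{v\})=\frac{k-2}{2}$ if $k$ is even, $=\frac{k-1}{2}$ if $k$ is odd (with no condition on the orientation). (2) If no vertex $v\in V(C_k^\sigma)$ is saturated in $G^\sigma\{v\}$, then: (a) if $k$ is odd, $G\cong U^*$ (with no condition on the orientation); (b) if $k$ is even, $G\cong U^*$ and $C_k^\sigma$ is evenly-oriented.
   Context: An oriented graph $G^\sigma$ is a simple graph $G$ (underlying graph) together with an orientation of each edge. Its skew-adjacency matrix $S(G^\sigma)=(s_{ij})$ has $s_{ij}=1$ if there is an arc from $v_i$ to $v_j$, $s_{ij}=-1$ if there is an arc from $v_j$ to $v_i$, and $0$ otherwise; the skew-rank $sr(G^\sigma)$ is its rank. For an even cycle $u_1\cdots u_ku_1$, its sign is the sign of $\prod_{i=1}^k s_{u_iu_{i+1}}$ ($u_{k+1}=u_1$); it is evenly-oriented if this sign is positive. For a vertex $v$ on the cycle, $G^\sigma\{v\}$ is the component containing $v$ of the graph obtained by deleting the cycle edges (a tree rooted at $v$). A vertex $v$ of a tree $T$ is saturated in $T$ if every maximum matching of $T$ covers $v$. $\beta(H)$ is the matching number. $U^*$ is the graph obtained from a cycle $C_k$ and a star $S_{n-k}$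 (on $n-k$ vertices) by adding an edge between a vertex of $C_k$ and the center of $S_{n-k}$.
   Formalization: Part (2) is stated for n > k, i.e. G is not just the cycle: an even cycle C_k of negative sign with n = k has sr = k and no saturated vertex, yet is not evenly-oriented and U* (with star S_0) is undefined. *)

(* Defs.v *)
From mathcomp Require Import all_boot all_order all_algebra.
Set Implicit Arguments. Unset Strict Implicit. Unset Printing Implicit Defensive.
Import Order.TTheory GRing.Theory Num.Theory.

Section Defs.
Variable n : nat.
Local Notation V := 'I_n.

Definition oriented (arc : rel V) : Prop :=
  irreflexive arc /\ (forall x y, arc x y -> ~~ arc y x).

Definition adj (arc : rel V) : rel V := fun x y => arc x y || arc y x.

(* skew-adjacency matrix (over the rationals; rank is the same as over R) *)
Definition skew_mx (arc : rel V) : 'M[rat]_n :=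
  \matrix_(i, j) (if arc i j then 1 else if arc j i then -1 else 0)%R.

Definition skew_rank (arc : rel V) : nat := \rank (skew_mx arc).

Definition connected_graph (e : rel V) : Prop := forall x y, connect e x y.

Definition is_cycle (e : rel V) (c : seq V) : Prop :=
  [/\ uniq c, 3 <= size c & cycle e c].

Definition cyc_edge (c : seq V) (x y : V) : bool :=
  [&& x \in c, y \in c, x != y & (next c x == y) || (next c y == x)].

Definition unicyclic_with_cycle (arc : rel V) (c : seq V) : Prop :=
  [/\ connected_graph (adj arc), is_cycle (adj arc) c &
      forall c', is_cycle (adj arc) c' -> forall x y, cyc_edge c' x y = cyc_edge c x y].

Definition evenly_oriented (arc : rel V) (c : seq V) : Prop :=
  (0 < \prod_(x <- c) skew_mx arc x (next c x))%R.

Definition adj_nocyc (arc : rel V) (c : seq V) : rel V :=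
  fun x y => adj arc x y && ~~ cyc_edge c x y.

Definition hang (arc : rel V) (c : seq V) (v : V) : {set V} :=
  [set x | connect (adj_nocyc arc c) v x].

Definition is_matching (A : {set V}) (e : rel V) (M : {set V * V}) : bool :=
  [forall p in M, [&& p.1 \in A, p.2 \in A & e p.1 p.2]] &&
  [forall p in M, forall q in M,
      (p != q) ==> [disjoint [set p.1; p.2] & [set q.1; q.2]]].

Definition matching_number (A : {set V}) (e : rel V) : nat :=
  \max_(M : {set V * V} | is_matching A e M) #|M|.

Definition covers (M : {set V * V}) (v : V) : bool :=
  [exists p in M, (p.1 == v) || (p.2 == v)].

Definition saturated (A : {set V}) (e : rel V) (v : V) : Prop :=
  forall M, is_matching A e M -> #|M| = matching_number A e -> covers M v.

Definition is_star (A : {set V}) (e : rel V) : Prop :=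
  exists2 z, z \in A &
    (forall x, x \in A -> x != z -> e z x) /\
    (forall x y, x \in A -> y \in A -> e x y -> (x == z) || (y == z)).

(* U^* on vertex set 'I_n: cycle 0,1,...,k-1, star center k joined to 0,
   leaves k+1,...,n-1 joined to k *)
Definition ustar_adj (k : nat) : rel V := fun x y =>
  let i := val x in let j := val y in
  [|| [&& i < k, j < k & (j == (i.+1 %% k)) || (i == (j.+1 %% k))],
      (i == 0) && (j == k), (i == k) && (j == 0),
      (i == k) && (k < j) | (j == k) && (k < i)].

Definition isomorphic_to_ustar (arc : rel V) (k : nat) : Prop :=
  exists f : V -> V, bijective f /\ forall x y, adj arc x y = ustar_adj k (f x) (f y).

End Defs.

(* Main.v *)
Require Import Defs.
From mathcomp Require Import all_boot all_order all_algebra.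
From mathcomp Require Import zify.

(** If a block [P] of a skew-symmetric matrix is such that the off-diagonal block below it is
    [X P] with [X P X^T = 0], then a congruence splits the matrix as [P] plus the complementary
    block, without correction term.  This computes every rank needed here:
    - removing a pendant edge shows by induction that a forest has skew-rank twice its matching
      number;
    - if [v] is saturated in the tree [T] hanging at [v], the unit vector at [v] lies in the row
      space of [T], and [sr G = sr T + sr (G - T)];
    - if no cycle vertex is saturated, each row of the coupling of the cycle to the hanging trees
      lies in the row space of its own tree minus the root, and [sr G = sr C + sr (G - C)].
    Comparing with the hypothesis on [sr G], since the path [C - v] already contributes
    [2 * ((k-1)/2)], leaves exactly one further matching edge.  A tree with matching number one
    is a star, and an even cycle that is not evenly oriented would have full rank. *)

Set Implicit Arguments. Unset Strict Implicit. Unset Printing Implicit Defensive.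
Import Order.TTheory GRing.Theory Num.Theory.

(** * Skew-symmetric matrices and coordinate projections *)

Section Mask.
Variable n : nat.
Local Open Scope ring_scope.
Implicit Types (A S X : 'M[rat]_n) (B : {set 'I_n}) (arc : rel 'I_n).

Definition coordmx B : 'M[rat]_n := diag_mx (\row_i (i \in B)%:R).

Lemma mul_coordmxE B m (A : 'M[rat]_(n, m)) i j :
  (coordmx B *m A) i j = (i \in B)%:R * A i j.
Proof. by rewrite mul_diag_mx !mxE. Qed.

Lemma mulmx_coordmxE B m (A : 'M[rat]_(m, n)) i j :
  (A *m coordmx B) i j = A i j * (j \in B)%:R.
Proof. by rewrite mul_mx_diag !mxE. Qed.

Lemma tr_coordmx B : (coordmx B)^T = coordmx B.
Proof. exact: tr_diag_mx. Qed.

Lemma coordmx_mul B1 B2 : coordmx B1 *m coordmx B2 = coordmx (B1 :&: B2).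
Proof.
apply/matrixP=> i j; rewrite mul_coordmxE !mxE inE.
by case: eqP => _; rewrite ?mulr0n ?mulr0 // !mulr1n -natrM mulnb.
Qed.

Lemma coordmx_id B : coordmx B *m coordmx B = coordmx B.
Proof. by rewrite coordmx_mul setIid. Qed.

Lemma coordmx0 : coordmx set0 = 0.
Proof. by apply/matrixP=> i j; rewrite !mxE inE mul0rn. Qed.

Lemma coordmxC B : coordmx B + coordmx (~: B) = 1%:M.
Proof.
apply/matrixP=> i j; rewrite !mxE inE -mulrnDl -natrD.
by case: (i \in B).
Qed.

Lemma coordmx_mulC B : coordmx B *m coordmx (~: B) = 0.
Proof. by rewrite coordmx_mul setICr coordmx0. Qed.

Lemma coordmxC_mul B : coordmx (~: B) *m coordmx B = 0.
Proof. by rewrite coordmx_mul setIC setICr coordmx0. Qed.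

(** The product is a scalar, hence equal to its own transpose, while skewness makes that transpose
    its negative. *)
Lemma skew_form0 A (x : 'rV[rat]_n) : A^T = - A -> x *m A *m x^T = 0.
Proof.
move=> AT; set M := x *m A *m x^T.
have MT : M^T = - M by rewrite /M !trmx_mul trmxK AT mulNmx mulmxN mulmxA.
have Mt : M^T = M by apply/matrixP=> i j; rewrite !ord1 [LHS]mxE.
apply/matrixP=> i j; rewrite !ord1 [RHS]mxE; apply/eqP.
have /matrixP/(_ 0 0)/eqP : M = - M by rewrite -MT Mt.
by rewrite [X in _ == X]mxE -subr_eq0 opprK -mulr2n mulrn_eq0.
Qed.

(** Multiplying the sum by [D] or [D'] recovers each block, so both row spaces lie in that of the
    sum; they meet in 0 because their columns have disjoint supports. *)
Lemma rank_coordmx_split B A :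
  let D := coordmx B in let D' := coordmx (~: B) in
  \rank (D *m A *m D + D' *m A *m D')%R = (\rank (D *m A *m D) + \rank (D' *m A *m D'))%N.
Proof.
move=> D D'; set P := D *m A *m D; set Q := D' *m A *m D'.
have EP : D *m (P + Q) = P.
  by rewrite mulmxDr /P /Q !mulmxA coordmx_id coordmx_mulC !mul0mx addr0.
have EQ : D' *m (P + Q) = Q.
  by rewrite mulmxDr /P /Q !mulmxA coordmx_id coordmxC_mul !mul0mx add0r.
have capPQ : (P :&: Q = 0)%MS.
  apply/eqP; rewrite -submx0; apply/rV_subP => w; rewrite sub_capmx => /andP[].
  case/submxP=> x Ex /submxP[y Ey].
  rewrite submx0 -[w]mulmx1 -(coordmxC B) mulmxDr {1}Ey Ex /P /Q !mulmxA.
  rewrite -(mulmxA _ D' (coordmx B)) coordmxC_mul -(mulmxA _ D (coordmx _)) coordmx_mulC.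
  by rewrite !mulmx0 addr0.
rewrite -(mxrank_disjoint_sum capPQ); apply/eqP; rewrite eqn_leq.
apply/andP; split; apply: mxrankS; first exact: addmx_sub_adds.
by rewrite addsmx_sub -[X in (X <= _)%MS]EP submxMl -[X in (X <= _)%MS]EQ submxMl.
Qed.

(** With [Y = D' X D] one has [Y Y = 0], so [1 - Y] is invertible with inverse [1 + Y]. Congruence
    by [1 - Y] clears both off-diagonal blocks, and the Schur correction [Y P Y^T] vanishes by the
    last hypothesis. *)
Lemma rank_congr S X B :
  let D := coordmx B in let D' := coordmx (~: B) in
  S^T = - S -> D' *m S *m D = X *m (D *m S *m D) ->
  X *m (D *m S *m D) *m X^T = 0 ->
  \rank S = (\rank (D *m S *m D) + \rank (D' *m S *m D'))%N.
Proof.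
move=> D D' ST EX X0; rewrite -rank_coordmx_split -/D -/D'.
set P := D *m S *m D in EX X0 *; set Q := D' *m S *m D'.
pose Y := D' *m X *m D.
have DT : D^T = D := tr_coordmx _. have DT' : D'^T = D' := tr_coordmx _.
have DP : D *m P = P by rewrite /P !mulmxA coordmx_id.
have PD : P *m D = P by rewrite /P -!mulmxA coordmx_id.
have PT : P^T = - P by rewrite /P !trmx_mul DT ST mulNmx mulmxN mulmxA.
have DQ : D *m Q = 0 by rewrite /Q !mulmxA coordmx_mulC !mul0mx.
have QD : Q *m D = 0 by rewrite /Q -mulmxA coordmxC_mul mulmx0.
have ES : S = P + Q + D' *m S *m D + D *m S *m D'.
  rewrite -[in LHS](mul1mx S) -[in LHS](mulmx1 (_ *m S)) -(coordmxC B).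
  rewrite !mulmxDl !mulmxDr -/D -/D' -/P -/Q -!addrA; congr (_ + _).
  by rewrite addrC -!addrA addrCA.
clearbody P Q.
have YP : Y *m P = D' *m S *m D.
  by rewrite /Y -!mulmxA DP -EX !mulmxA coordmx_id.
have PY : P *m Y^T = D *m S *m D'.
  rewrite -[P]opprK -PT mulNmx -trmx_mul YP !trmx_mul DT DT' ST.
  by rewrite mulNmx mulmxN opprK mulmxA.
have YPY : Y *m P *m Y^T = 0.
  rewrite /Y !trmx_mul DT DT' -!mulmxA (mulmxA D P) DP (mulmxA P D) PD.
  by rewrite !mulmxA -(mulmxA D' X) -(mulmxA D' (X *m P)) X0 mulmx0 mul0mx.
have YY : Y *m Y = 0.
  by rewrite /Y !mulmxA -(mulmxA _ D D') coordmx_mulC mulmx0 !mul0mx.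
have YTY : Y^T *m Y^T = 0 by rewrite -trmx_mul YY trmx0.
have U : (1%:M - Y) *m (1%:M + Y) = 1%:M.
  by rewrite mulmxDr !mulmxBl YY !mul1mx !mulmx1 subr0 subrK.
have [U1 _] := mulmx1_unit U.
have U2 : (1%:M - Y)^T \in unitmx by rewrite unitmx_tr.
rewrite -YP -PY in ES.
have US : (1%:M - Y) *m S *m (1%:M - Y)^T = P + Q.
  have YQ : Y *m Q = 0 by rewrite /Y -mulmxA DQ mulmx0.
  have QY : Q *m Y^T = 0 by rewrite /Y !trmx_mul DT (mulmxA Q) QD mul0mx.
  have -> : (1%:M - Y) *m S = P + Q + P *m Y^T.
    rewrite mulmxBl mul1mx {2}ES !mulmxDr YQ mulmxA YY mul0mx !addr0 mulmxA YPY addr0.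
    by rewrite ES addrAC addrK.
  rewrite linearB /= trmx1 mulmxBr mulmx1 !mulmxDl QY addr0 -mulmxA YTY mulmx0 addr0.
  by rewrite addrK.
rewrite -US mxrankMfree ?row_free_unit // -(mxrank_tr (_ *m S)) trmx_mul.
by rewrite mxrankMfree ?mxrank_tr // row_free_unit.
Qed.

(** The row space of [D A D] lies in that of [A D], whose rank is at most that of [A]; the rank
    hypothesis forces the two spaces to coincide. *)
Lemma row_in_of_rank_le A v : A^T = - A ->
  let D := coordmx [set~ v] in (\rank A <= \rank (D *m A *m D)%R)%N ->
  exists x : 'rV_n, row v (A *m D) = x *m (D *m A *m D).
Proof.
move=> AT D le_rk; apply/submxP/(submx_trans (row_sub _ _)).
have le1 : (D *m A *m D <= A *m D)%MS by rewrite -mulmxA submxMl.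
rewrite -(geq_leqif (mxrank_leqif_sup le1)).
by rewrite (leq_trans _ le_rk) // mxrankM_maxl.
Qed.

Lemma delta_in_of_rank_gt A v : A^T = - A ->
  let D := coordmx [set~ v] in (\rank (D *m A *m D)%R < \rank A)%N ->
  exists y : 'rV_n, y *m A = delta_mx 0 v.
Proof.
move=> AT D lt_rk; case: (boolP ((delta_mx 0 v : 'rV_n) <= A)%MS) => [/submxP[y ->]|].
  by exists y.
rewrite submxE => /eqP/matrixP nz.
(* The columns of [cokermx A] detect exactly the row space of [A], so a unit vector outside it gives
   a nonzero entry in row [v]. *)
have [j nzj] : exists j, row v (cokermx A) 0 j != 0.
  apply/existsP; rewrite -negb_forall; apply/negP=> /forallP z0; case: nz => i j.
  by rewrite -rowE ord1 (eqP (z0 j)) mxE.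
(* A kernel vector [z] with [z v = 1] makes column [v] redundant, and row [v] by skewness. *)
pose z := ((row v (cokermx A) 0 j)^-1) *: col j (cokermx A).
have Az : A *m z = 0 by rewrite /z -scalemxAr colE mulmxA mulmx_coker mul0mx scaler0.
have zv : z v 0 = 1.
  rewrite /z; move: nzj; set K := cokermx A; clearbody K; rewrite !mxE; exact: mulVf.
clearbody z; pose W := 1%:M - z *m delta_mx 0 v.
have AW : A *m W = A by rewrite mulmxBr mulmx1 mulmxA Az mul0mx subr0.
have DW : D *m W = W.
  apply/matrixP=> a b; rewrite mul_coordmxE !inE; case: eqP => [->|_]; last by rewrite mul1r.
  rewrite mul0r !mxE big_ord_recl big_ord0 !mxE ord1 zv mul1r addr0 !eqxx /=.
  by rewrite eq_sym subrr.
move: lt_rk; rewrite ltnNge => /negP[].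
have DT : D^T = D := tr_coordmx _.
apply: (@leq_trans (\rank (A *m D))); first by rewrite -{1}AW -DW mulmxA mxrankM_maxl.
rewrite -mxrank_tr trmx_mul AT DT mulmxN mxrank_opp -{1}AW -DW !mulmxA.
by rewrite mxrankM_maxl.
Qed.

Lemma rank_coordmx B : \rank (coordmx B) = #|B|.
Proof.
have [k] := ubnP #|B|; elim: k B => // k IHk B; rewrite ltnS => leB.
have [->|[x xB0]] := set_0Vmem B; first by rewrite coordmx0 mxrank0 cards0.
move: leB; rewrite -(setD1K xB0); set B' := B :\ x; have xB : x \notin B' by rewrite !inE eqxx.
rewrite cardsU1 xB => /IHk; move: B' xB => {xB0 IHk}B xB IH.
have [E1 E2] : [set x] :&: (x |: B) :&: [set x] = [set x] /\
   ~: [set x] :&: (x |: B) :&: ~: [set x] = B.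
  by split; apply/setP=> y; rewrite !inE; case: eqP => [->|_] /=; rewrite ?andbT ?(negPf xB).
have := rank_coordmx_split [set x] (coordmx (x |: B)); rewrite /= !coordmx_mul E1 E2 IH.
have -> : coordmx [set x] = delta_mx x x.
  apply/matrixP=> i j; rewrite !mxE inE; case: (i =P x) => [->|_] /=.
    by rewrite eq_sym.
  by rewrite mul0rn.
rewrite mxrank_delta => <-; congr (\rank _).
apply/matrixP=> i j; rewrite !mxE !inE.
case: (i =P j) => [<-|ij].
  by rewrite andbb; case: eqP => [->|_]; rewrite ?(negPf xB) ?addr0 ?add0r.
rewrite !mulr0n addr0; case: (i =P x) => //= ix.
by case: (j =P x) => // jx; case: ij; rewrite ix jx.
Qed.
End Mask.

(** * Induced subgraphs and their skew-adjacency matrices *)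

Section Restriction.
Variable n : nat.
Implicit Types (A B : {set 'I_n}) (arc e : rel 'I_n).

(** The induced subgraph on [A], kept on the full vertex type: vertices outside [A] become isolated,
    which adds only zero rows and columns and leaves the rank unchanged. *)
Definition sub_rel A e : rel 'I_n := fun x y => [&& x \in A, y \in A & e x y].

Lemma adj_sym arc : symmetric (adj arc).
Proof. by move=> x y; rewrite /adj orbC. Qed.

Lemma adj_irr arc : oriented arc -> irreflexive (adj arc).
Proof. by case=> irr _ x; rewrite /adj irr. Qed.

Lemma sub_rel_sym A e : symmetric e -> symmetric (sub_rel A e).
Proof. by move=> sym x y; rewrite /sub_rel sym andbCA. Qed.

Lemma oriented_sub A arc : oriented arc -> oriented (sub_rel A arc).
Proof.
case=> irr anti; split=> [x|x y]; first by rewrite /sub_rel irr !andbF.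
by case/and3P=> _ _ /anti nyx; rewrite /sub_rel (negPf nyx) !andbF.
Qed.

Lemma tr_skew_mx arc : oriented arc -> ((skew_mx arc)^T = - skew_mx arc)%R.
Proof.
case=> _ anti; apply/matrixP=> i j; rewrite !mxE.
case: ifP => [/anti/negPf->|_]; first by [].
by case: ifP => _; rewrite ?opprK ?oppr0.
Qed.

Lemma coordmx_skew_mx A arc :
  (coordmx A *m skew_mx arc *m coordmx A = skew_mx (sub_rel A arc))%R.
Proof.
apply/matrixP=> i j; rewrite mulmx_coordmxE mul_coordmxE !mxE /sub_rel.
by case: (i \in A); case: (j \in A); rewrite ?mul1r ?mulr1 ?mul0r ?mulr0.
Qed.

Lemma eq_skew_mx arc arc' : arc =2 arc' -> skew_mx arc = skew_mx arc'.
Proof. by move=> E; apply/matrixP=> i j; rewrite !mxE !E. Qed.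

Lemma skew_mx_sub_sub A B arc :
  skew_mx (sub_rel A (sub_rel B arc)) = skew_mx (sub_rel (A :&: B) arc).
Proof.
by apply: eq_skew_mx => x y; rewrite /sub_rel !inE -!andbA; do !bool_congr.
Qed.

Lemma coordmx_skew_mx_sub A B arc :
  (coordmx A *m skew_mx (sub_rel B arc) *m coordmx A = skew_mx (sub_rel (A :&: B) arc))%R.
Proof. by rewrite coordmx_skew_mx skew_mx_sub_sub. Qed.

Lemma skew_mx_eq0 arc i j : (skew_mx arc i j == 0)%R = ~~ adj arc i j.
Proof. by rewrite mxE /adj; case: (arc i j); case: (arc j i). Qed.

Lemma leq_rank_sub A B arc : A \subset B ->
  \rank (skew_mx (sub_rel A arc)) <= \rank (skew_mx (sub_rel B arc)).
Proof.
move=> /setIidPl AB; rewrite -{1}AB -coordmx_skew_mx_sub.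
by apply: leq_trans (mxrankM_maxl _ _) (mxrankM_maxr _ _).
Qed.

End Restriction.

(** * Matchings *)

Section Matching.
Variable n : nat.
Implicit Types (A B : {set 'I_n}) (e : rel 'I_n) (M : {set 'I_n * 'I_n}).

(** Edges are ordered pairs here; the second clause also forbids [(x, y)] and [(y, x)] together, so
    no edge is counted twice. *)
Lemma is_matchingP A e M : reflect
  ((forall p, p \in M -> [/\ p.1 \in A, p.2 \in A & e p.1 p.2]) /\
   (forall p q x, p \in M -> q \in M -> x \in [set p.1; p.2] -> x \in [set q.1; q.2] ->
      p = q))
  (is_matching A e M).
Proof.
apply: (iffP andP) => [[/forall_inP H1 /forall_inP H2]|[H1 H2]]; split.
- by move=> p /H1/and3P.
- move=> p q x pM qM xp xq; apply/eqP; apply/negPn/negP=> npq.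
  have /forall_inP/(_ q qM)/implyP/(_ npq) := H2 p pM.
  by move/disjointFr/(_ xp); rewrite xq.
- by apply/forall_inP=> p /H1/and3P.
- apply/forall_inP=> p pM; apply/forall_inP=> q qM; apply/implyP=> npq.
  rewrite disjoint_subset; apply/subsetP=> x xp; rewrite inE; apply/negP=> xq.
  by rewrite (H2 _ _ _ pM qM xp xq) eqxx in npq.
Qed.

Lemma is_matching0 A e : is_matching A e set0.
Proof. by apply/is_matchingP; split=> [p|p q x]; rewrite inE. Qed.

Lemma matching_numberP A e :
  exists2 M, is_matching A e M & #|M| = matching_number A e.
Proof.
have [|M MA E] := @eq_bigmax_cond _ (is_matching A e) (fun M => #|M|).
  by apply/card_gt0P; exists set0; apply: is_matching0.
by exists M; rewrite // -E.
Qed.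

Lemma leq_matching A e M : is_matching A e M -> #|M| <= matching_number A e.
Proof. by move=> H; rewrite /matching_number (leq_bigmax_cond M). Qed.

Lemma eq_is_matching A e e' M : {in A &, e =2 e'} -> is_matching A e M = is_matching A e' M.
Proof.
move=> E; rewrite /is_matching; congr (_ && _); apply: eq_forallb => p.
case: (p \in M) => //=; case: (boolP (p.1 \in A)) => //= ?.
by case: (boolP (p.2 \in A)) => //= ?; rewrite E.
Qed.

Lemma eq_matching_number A e e' : {in A &, e =2 e'} ->
  matching_number A e = matching_number A e'.
Proof. by move=> E; apply: eq_bigl => M; apply: eq_is_matching. Qed.

Lemma sub_matching A B e M : A \subset B -> is_matching A e M -> is_matching B e M.
Proof.
move=> /subsetP AB /is_matchingP[H1 H2]; apply/is_matchingP; split=> // p /H1[? ? ?].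
by split=> //; apply: AB.
Qed.

Lemma leq_matching_number A B e : A \subset B ->
  matching_number A e <= matching_number B e.
Proof. by have [M MA <-] := matching_numberP A e => /sub_matching/(_ MA)/leq_matching. Qed.

Lemma matching_mem A e M p x : is_matching A e M -> p \in M ->
  x \in [set p.1; p.2] -> x \in A.
Proof. by move=> /is_matchingP[H _] /H[? ? _]; rewrite !inE => /orP[]/eqP->. Qed.

Lemma matching_numberU A B e : [disjoint A & B] ->
  matching_number A e + matching_number B e <= matching_number (A :|: B) e.
Proof.
move=> dAB; have [M MA <-] := matching_numberP A e.
have [N NB <-] := matching_numberP B e.
have xAB x : x \in A -> x \in B -> False by move=> xA; rewrite (disjointFr dAB xA).
rewrite -cardsUI (_ : M :&: N = set0) ?cards0 ?addn0; last first.
  apply/setP=> p; rewrite !inE; apply/negP=> /andP[pM pN].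
  have p1 : p.1 \in [set p.1; p.2] by rewrite set21.
  exact: (xAB _ (matching_mem MA pM p1) (matching_mem NB pN p1)).
apply: leq_matching; apply/is_matchingP.
have [H1 H2] := is_matchingP _ _ _ MA; have [K1 K2] := is_matchingP _ _ _ NB.
split=> [p /setUP[/H1|/K1] [h1 h2 ?]|p q x].
- by split=> //; rewrite inE ?h1 ?h2.
- by split=> //; rewrite inE ?h1 ?h2 orbT.
case/setUP=> [pM|pN] /setUP[qM|qN] xp xq; [exact: H2 xp xq| | |exact: K2 xp xq].
- by case: (xAB x); [apply: matching_mem MA pM _ | apply: matching_mem NB qN _].
- by case: (xAB x); [apply: matching_mem MA qM _ | apply: matching_mem NB pN _].
Qed.

Lemma matching_edge A e x y : x \in A -> y \in A -> e x y -> 0 < matching_number A e.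
Proof.
move=> xA yA exy; apply: (@leq_trans #|[set (x, y)]|); first by rewrite cards1.
apply: leq_matching; apply/is_matchingP; split=> [p|p q z]; rewrite !inE.
  by move/eqP->.
by move=> /eqP-> /eqP->.
Qed.

Lemma matching_number_gt0 A e : 0 < matching_number A e ->
  exists x y, [/\ x \in A, y \in A & e x y].
Proof.
have [M /is_matchingP[MA _] <-] := matching_numberP A e.
by case/card_gt0P=> -[x y] /MA; exists x, y.
Qed.

(** At most one matching edge meets [w], and any matching edge at [u] is such an edge. Dropping it
    leaves a matching that avoids both; conversely the edge [u w] can always be added. *)
Lemma matching_pendant A e u w : symmetric e -> u \in A -> w \in A -> u != w -> e u w ->
    (forall z, z \in A -> e u z -> z = w) ->
  matching_number A e = (matching_number (A :\: [set u; w]) e).+1.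
Proof.
move=> sym uA wA uw euw pend; apply/eqP; rewrite eqn_leq; apply/andP; split; last first.
  have dis : [disjoint [set u; w] & A :\: [set u; w]].
    by rewrite disjoint_sym disjoints_subset subsetDr.
  have sAB : [set u; w] :|: A :\: [set u; w] \subset A.
    by rewrite subUset subsetDl subUset !sub1set uA wA.
  rewrite (leq_trans _ (leq_matching_number e sAB)) //.
  rewrite (leq_trans _ (matching_numberU e dis)) // -add1n leq_add2r.
  by apply: (@matching_edge _ _ u w); rewrite ?set21 ?set22.
have [M MA <-] := matching_numberP A e; have [H1 H2] := is_matchingP _ _ _ MA.
pose W := [set p in M | w \in [set p.1; p.2]].
have W1 : #|W| <= 1.
  apply/card_le1_eqP => p q; rewrite inE => /andP[pM wp]; rewrite inE => /andP[qM wq].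
  exact: H2 wq wp.
rewrite -(cardsID W M) -addn1 addnC leq_add //; last first.
  by rewrite (leq_trans _ W1) // subset_leq_card // subsetIr.
apply: leq_matching; apply/is_matchingP; split=> [p|p q x]; last first.
  by case/setDP=> [pM _] /setDP[qM _]; apply: H2.
rewrite inE => /andP[pW pM]; have [p1A p2A ep] := H1 _ pM.
move: pW; rewrite inE pM /= !inE negb_or => /andP[w1 w2].
rewrite p1A p2A ep !(eq_sym _ w) (negPf w1) (negPf w2) !orbF !andbT; split=> //.
  by apply/eqP=> p1u; rewrite (pend p.2) ?eqxx // -?p1u // in w2.
by apply/eqP=> p2u; rewrite (pend p.1) ?eqxx // -?p2u 1?sym // in w1.
Qed.

Lemma matching_del A e M v : is_matching A e M -> ~~ covers M v -> is_matching (A :\ v) e M.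
Proof.
move=> MA /existsPn nc; have [H1 H2] := is_matchingP _ _ _ MA.
apply/is_matchingP; split=> // p pM; have [p1A p2A ep] := H1 _ pM.
by have := nc p; rewrite pM /= negb_or !inE => /andP[-> ->].
Qed.

(** With equality, a maximum matching of [A :\ v] would be a maximum matching of [A] that misses
    [v]. *)
Lemma saturated_gt A e v : saturated A e v ->
  matching_number (A :\ v) e < matching_number A e.
Proof.
move=> sat; have [M MA E] := matching_numberP (A :\ v) e.
rewrite ltn_neqAle leq_matching_number ?subD1set // andbT -E; apply/eqP=> EM.
have := sat M (sub_matching (subD1set _ _) MA) EM.
case/existsP=> p /andP[pM pv]; have [/(_ p pM)[]] := is_matchingP _ _ _ MA.
by rewrite !inE; case/orP: pv => ->.
Qed.

(** [saturated] is a [Prop], but a maximum matching missing [v] can be searched for among finitely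
    many sets, so the case split is constructive. *)
Lemma unsaturated_leq A e v : ~ saturated A e v ->
  matching_number A e <= matching_number (A :\ v) e.
Proof.
case: (boolP [exists M, [&& is_matching A e M, #|M| == matching_number A e & ~~ covers M v]]).
  case/existsP=> M /and3P[MA /eqP<- nc] _.
  exact: leq_matching (matching_del MA nc).
move/existsPn=> H []; move=> M MA EM; have := H M.
by rewrite MA EM eqxx /= negbK.
Qed.

(** Matches the first two vertices and continues two vertices further on; [(size p).+1] is the
    number of vertices of the path. *)
Lemma matching_path e x p : path e x p -> uniq (x :: p) ->
  (size p).+1./2 <= matching_number [set z in x :: p] e.
Proof.
have [k] := ubnP (size p); elim: k x p => // k IHk x [|y [|z p]] //=.
  rewrite andbT => _ exy _; apply: (@matching_edge _ _ x y) => //; by rewrite !inE eqxx ?orbT.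
rewrite !ltnS => szp /and3P[exy eyz ezp] /and3P[xN yN up].
have := IHk z p (ltnW szp) ezp up.
set B := [set _ in z :: p] => le.
have -> : [set t in [:: x, y, z & p]] = [set x; y] :|: B.
  by apply/setP=> t; rewrite !inE -!orbA.
apply: leq_trans (matching_numberU e _).
  rewrite -addn1 addnC leq_add //.
  by apply: (@matching_edge _ _ x y); rewrite ?set21 ?set22.
rewrite disjoint_subset; apply/subsetP=> t; rewrite !inE => /orP[]/eqP->.
  by move: xN; rewrite !inE !negb_or => /andP[].
by move: yN; rewrite !inE.
Qed.
End Matching.

(** * Forests *)

Section Forest.
Variable n : nat.
Implicit Types (A B : {set 'I_n}) (arc e : rel 'I_n).

Definition acyclic e := forall c, ~ is_cycle e c.

Lemma sub_is_cycle e e' c : subrel e e' -> is_cycle e c -> is_cycle e' c.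
Proof. by move=> ee' [uc sc cc]; split=> //; apply: sub_cycle cc. Qed.

(** A simple path is extended at its front until this is impossible. A further neighbour of the
    front vertex would either prolong the path or close a cycle, so the front vertex is pendant. *)
Lemma acyclic_pendant e x y : symmetric e -> irreflexive e -> acyclic e -> e x y ->
  exists u w, e u w /\ forall z, e u z -> z = w.
Proof.
move=> sym irr acyc exy.
suff: forall p x y, path e x (y :: p) -> uniq [:: x, y & p] ->
  exists u w, e u w /\ forall z, e u z -> z = w.
  move/(_ [::] x y); apply; first by rewrite /= exy.
  by rewrite /= inE andbT; apply/negP=> /eqP xy; rewrite xy irr in exy.
move=> {exy x y} p; have [k] := ubnP (n - size p); elim: k p => // k IHk p ltk x y pth un.
have [/existsP[z /andP[exz zy]]|no] := boolP [exists z, e x z && (z != y)]; last first.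
  exists x, y; split=> [|z exz]; first by case/andP: pth.
  by apply/eqP; move/existsPn/(_ z): no; rewrite exz /= negbK.
have [zp|zNp] := boolP (z \in p); last first.
  have un' : uniq [:: z, x, y & p].
    rewrite cons_uniq un andbT !inE (negPf zy) (negPf zNp) !orbF.
    by apply/negP=> /eqP zx; rewrite zx irr in exz.
  have sz : (size p).+3 <= n.
    by have := card_uniqP un'; rewrite /= => <-; rewrite -[X in _ <= X]card_ord max_card.
  apply: (IHk (y :: p) _ z x) => //=; first by lia.
  by rewrite sym exz.
(* The initial segment of the path up to [z], closed by the edge [z x], is a cycle. *)
case: (splitPr zp) => p1 p2 in pth un; case: (acyc [:: x, y & rcons p1 z]).
move: un pth; rewrite -cat_rcons -!cat_cons cat_uniq => /andP[un _].
rewrite cat_path => /andP[pth _]; split=> //; first by rewrite /= size_rcons.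
change (path e x (rcons (y :: rcons p1 z) x)); rewrite rcons_path.
 by rewrite pth /= last_rcons sym.
Qed.

(** The block on [u, w] is an invertible 2 by 2 skew matrix. Outside it, column [u] vanishes, so
    each coupling row is a multiple of row [u] of the block: [X] is a column times the unit vector
    at [u], and [X P X^T = 0] by [skew_form0]. *)
Lemma rank_pendant arc A u w : oriented arc ->
    u \in A -> w \in A -> adj arc u w -> (forall z, z \in A -> adj arc u z -> z = w) ->
  \rank (skew_mx (sub_rel A arc)) = (\rank (skew_mx (sub_rel (A :\: [set u; w]) arc))).+2.
Proof.
move=> ori uA wA auw pend; set S := skew_mx (sub_rel A arc).
have uw : u != w by apply/negP=> /eqP uw; rewrite uw adj_irr in auw.
have ST : (S^T = - S)%R by apply/tr_skew_mx/oriented_sub.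
pose B := [set u; w]; have [P PD] : {P | P = coordmx B *m S *m coordmx B}%R by eexists.
have uB : u \in B by rewrite set21. have wB : w \in B by rewrite set22.
have PE i j : (P i j = (i \in B)%:R * S i j * (j \in B)%:R)%R.
  by rewrite PD mulmx_coordmxE mul_coordmxE.
have PT : (P^T = - P)%R.
  by rewrite PD !trmx_mul tr_coordmx ST mulNmx mulmxN mulmxA.
have S_u i : i \notin B -> (S i u = 0)%R.
  move=> iB; apply/eqP; rewrite skew_mx_eq0 /adj /sub_rel uA /=.
  case: (boolP (i \in A)) => //= iA; rewrite -/(adj arc i u) adj_sym.
  by apply/negP=> /(pend _ iA) iw; rewrite iw wB in iB.
have Sii i : (S i i = 0)%R.
  by apply/eqP; rewrite skew_mx_eq0 adj_irr //; apply: oriented_sub.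
set s := (S u w).
have s0 : (s != 0)%R by rewrite skew_mx_eq0 negbK /adj /sub_rel uA wA.
have Swu : (S w u = - s)%R by transitivity (S^T u w)%R; [rewrite [RHS]mxE | rewrite ST [LHS]mxE].
(* Row [w] of [P] is [- s] times the unit vector at [u], and row [u] is [s] times the one at [w]; so
   both unit vectors lie in the row space. *)
have rP : \rank P = 2.
  have rB : \rank (coordmx B) = 2 by rewrite rank_coordmx cards2 uw.
  apply/eqP; rewrite eqn_leq -{1}rB {1}PD mxrankM_maxr /= -rB mxrankS //.
  apply/row_subP=> i; have [iB|iNB] := boolP (i \in B); last first.
    suff -> : row i (coordmx B) = 0%R by apply: sub0mx.
    by apply/rowP=> j; rewrite !mxE (negPf iNB) mul0rn.
  have : exists a k, row i (coordmx B) = (a *: row k P)%R.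
    have {iB} /orP[/eqP->|/eqP->] : (i == u) || (i == w) by move: iB; rewrite !inE.
      exists (- s^-1)%R, w; apply/rowP=> j; rewrite !mxE PE uB wB mul1r.
      rewrite !inE; case: (u =P j) => [<-|uj] /=.
        by rewrite Swu eqxx mulr1 mulrNN mulVf.
      case: (j =P u) uj => [->//|_ _] /=; case: (j =P w) => [->|_].
        by rewrite Sii mul0r mulr0.
      by rewrite !mulr0.
    exists (s^-1)%R, u; apply/rowP=> j; rewrite !mxE PE uB wB mul1r.
    rewrite !inE; case: (w =P j) => [<-|wj] /=.
      by rewrite -/s eqxx orbT mulr1 mulVf.
    case: (j =P w) wj => [->//|_ _]; rewrite orbF; case: (j =P u) => [->|_].
      by rewrite Sii mul0r mulr0.
    by rewrite !mulr0.
  by case=> a [k ->]; apply/scalemx_sub/row_sub.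
(* Row [u] of [P] has its only nonzero entry [s] at [w], hence the division by [s]. *)
pose a : 'cV[rat]_n := (\col_i ((i \notin B)%:R * S i w / s))%R.
rewrite (@rank_congr _ S (a *m delta_mx 0 u)%R B) //.
- by rewrite -PD rP coordmx_skew_mx_sub setIC setDE.

- rewrite -PD -(mulmxA a) -rowE; apply/matrixP=> i j.
  rewrite mulmx_coordmxE mul_coordmxE [RHS]mxE big_ord1 [a i _]mxE [row u P _ j]mxE PE uB mul1r.
  rewrite in_setC; case: (boolP (i \in B)) => iB; rewrite ?mul0r // !mul1r.
  case: (boolP (j \in B)); last by rewrite !mulr0.
  rewrite !inE => /orP[]/eqP->; first by rewrite S_u // Sii !mulr0 mul0r.
  by rewrite !mulr1 divfK.
rewrite -PD trmx_mul !mulmxA -(mulmxA a) -(mulmxA a).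
by rewrite (skew_form0 _ PT) mulmx0 mul0mx.
Qed.

Lemma rank_forest arc A : oriented arc -> acyclic (sub_rel A (adj arc)) ->
  \rank (skew_mx (sub_rel A arc)) = (matching_number A (adj arc)).*2.
Proof.
move=> ori; have [k] := ubnP #|A|; elim: k A => // k IHk A ltA acyc.
have [|no] := posnP (matching_number A (adj arc)); last first.
  have [x [y [xA yA exy]]] := matching_number_gt0 no.
  have exy' : sub_rel A (adj arc) x y by rewrite /sub_rel xA yA.
  have irr : irreflexive (sub_rel A (adj arc)) by move=> z; rewrite /sub_rel adj_irr ?andbF.
  have [u [w [/and3P[uA wA euw] pend]]] :=
    acyclic_pendant (sub_rel_sym A (adj_sym arc)) irr acyc exy'.
  have {}pend z : z \in A -> adj arc u z -> z = w.
    by move=> zA euz; apply: pend; rewrite /sub_rel uA zA.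
  have uw : u != w by apply/negP=> /eqP uw; rewrite uw adj_irr in euw.
  rewrite (rank_pendant ori uA wA euw pend) IHk.
  - by rewrite (matching_pendant (adj_sym arc) uA wA uw euw pend) doubleS.
  - rewrite (leq_trans _ (ltA : #|A| <= k)) // proper_card // properEneq subsetDl andbT.
    by apply/eqP=> /setP/(_ u); rewrite !inE eqxx uA.
  move=> c cyc; apply: (acyc c); apply: sub_is_cycle cyc => a b.
  by rewrite /sub_rel !inE => /and3P[/andP[_ ->] /andP[_ ->] ->].
move=> no; rewrite no double0; apply/eqP; rewrite mxrank_eq0; apply/eqP/matrixP=> i j.
rewrite [RHS]mxE; apply/eqP; rewrite skew_mx_eq0; apply/negP.
rewrite /adj /sub_rel => H; suff: 0 < matching_number A (adj arc) by rewrite no.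
have [iA jA] : i \in A /\ j \in A by case/orP: H => /and3P[].
by apply: (matching_edge iA jA); rewrite /adj; case/orP: H => /and3P[_ _ ->]; rewrite ?orbT.
Qed.
End Forest.

(** * Ranks of glued graphs *)

Section Gluing.
Variable n : nat.
Implicit Types (A B C T : {set 'I_n}) (arc e : rel 'I_n).
Local Open Scope ring_scope.

(** The rank drop gives [y] with [y P] the unit vector at [v]. Since [T] meets the rest only through
    [v], the coupling is a column [r] times that vector, so [X = r y], and [y P y^T = 0] by
    skewness. *)
Lemma rank_cut_vertex arc T v : oriented arc -> v \in T ->
    (forall x y, x \in T -> y \notin T -> adj arc x y -> x = v) ->
    (\rank (skew_mx (sub_rel (T :\ v) arc)) < \rank (skew_mx (sub_rel T arc)))%N ->
  \rank (skew_mx arc) =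
    (\rank (skew_mx (sub_rel T arc)) + \rank (skew_mx (sub_rel (~: T) arc)))%N.
Proof.
move=> ori vT cut lt_rk; set S := skew_mx arc.
have ST : S^T = - S := tr_skew_mx ori.
have PT := tr_skew_mx (oriented_sub T ori).
have [|y yP] := delta_in_of_rank_gt (v := v) PT.
  by rewrite coordmx_skew_mx_sub setIC -setDE.
have [r rE] : {r : 'cV[rat]_n | forall i, r i 0 = (i \in ~: T)%:R * S i v}.
  by exists (\col_i ((i \in ~: T)%:R * S i v)) => i; rewrite mxE.
rewrite (@rank_congr _ S (r *m y) T) // !coordmx_skew_mx //.
  rewrite -(mulmxA r) yP; apply/matrixP=> i j.
  rewrite mulmx_coordmxE mul_coordmxE [RHS]mxE big_ord1 rE [delta_mx _ _ _ _]mxE eqxx /= in_setC.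
  have [iT|iT] := boolP (i \in T); first by rewrite !mul0r.
  rewrite !mul1r; case: (j =P v) => [->|jv]; first by rewrite vT.
  rewrite mulr0; have [jT|] := boolP (j \in T); last by rewrite mulr0.
  rewrite mulr1; apply/eqP; rewrite skew_mx_eq0; apply/negP; rewrite adj_sym => ji.
  by case: jv; apply: cut ji.
by rewrite trmx_mul !mulmxA -(mulmxA r) -(mulmxA r) (skew_form0 y PT) mulmx0 mul0mx.
Qed.

(** [rank_congr] is applied with the roles exchanged: the block that is split off is the complement
    of [C], and the coupling rows are indexed by [C]. *)
Lemma rank_attached arc C (H : 'I_n -> {set 'I_n}) : oriented arc ->
    (forall v x, v \in C -> x \notin C -> adj arc v x -> x \in H v) ->
    (forall v w, v \in C -> w \in C -> v != w -> [disjoint H v & H w]) ->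
    (forall v x y, v \in C -> x \in H v -> y \notin H v -> x \notin C -> y \notin C ->
       ~~ adj arc x y) ->
    (forall v x, v \in C -> x \in C -> (x \in H v) = (x == v)) ->
    (forall v, v \in C -> \rank (skew_mx (sub_rel (H v) arc)) <=
       \rank (skew_mx (sub_rel (H v :\ v) arc)))%N ->
  \rank (skew_mx arc) =
    (\rank (skew_mx (sub_rel C arc)) + \rank (skew_mx (sub_rel (~: C) arc)))%N.
Proof.
move=> ori near dis sep HC unsat; set S := skew_mx arc.
have ST : S^T = - S := tr_skew_mx ori.
have S0 i j : ~~ adj arc i j -> S i j = 0 by rewrite -skew_mx_eq0 => /eqP.
pose D := coordmx (~: C); have [P PD] : {P | P = D *m S *m D} by eexists.
have PT : P^T = - P.
  by rewrite PD !trmx_mul tr_coordmx ST mulNmx mulmxN mulmxA.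
(* [f v] writes the coupling row of [v] as a combination of rows of [P] taken only from [H v :\ v];
   this support condition is what later separates distinct vertices. Outside [C] the value is a
   dummy 0. *)
have /fin_all_exists[f fP] v : exists x : 'rV[rat]_n, v \in C ->
    x *m P = row v (S *m D) /\ forall j, j \notin H v :\ v -> x 0 j = 0.
  have [vC|] := boolP (v \in C); last by exists 0.
  have := @row_in_of_rank_le _ (skew_mx (sub_rel (H v) arc)) v (tr_skew_mx (oriented_sub _ ori)).
  have vH : v \in H v by rewrite HC.
  rewrite /= coordmx_skew_mx_sub setIC -setDE => /(_ (unsat v vC))[x xE].
  set K := H v :\ v in xE *; exists (x *m coordmx K) => _; split; last first.
    by move=> j jK; rewrite mulmx_coordmxE (negPf jK) mulr0.
  have KC j : j \in K -> j \notin C.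
    by rewrite !inE => /andP[jv jH]; apply: contra jv => jC; rewrite -HC.
  (* No edge leaves [K] within the complement of [C], so the rows of [K] there are those of the
     graph induced on [K]. *)
  have E : coordmx K *m S *m D = skew_mx (sub_rel K arc).
    rewrite -coordmx_skew_mx; apply/matrixP=> i j; rewrite !mulmx_coordmxE !mul_coordmxE.
    have [iK|_] := boolP (i \in K); last by rewrite !mul0r.
    have [jK|jK] := boolP (j \in K); first by rewrite in_setC KC.
    rewrite in_setC; case: (boolP (j \in C)) => jC; first by rewrite !mulr0.
    rewrite S0 ?mul1r ?mul0r //; apply: (sep v) => //; last exact: KC.
      by move: iK; rewrite inE => /andP[].
    by apply: contra jK => jH; rewrite !inE jH andbT; apply: contraNneq jC => ->.
  have KD : coordmx K *m D = coordmx K.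
    rewrite coordmx_mul (setIidPl _) //; apply/subsetP=> j jK; rewrite inE; exact: KC.
  rewrite PD !mulmxA -(mulmxA x) KD -(mulmxA x) -(mulmxA x) E -xE.
  apply/rowP=> j; rewrite [LHS]mxE [RHS]mxE !mulmx_coordmxE in_setC !inE.
  have -> : skew_mx (sub_rel (H v) arc) v j = (j \in H v)%:R * S v j.
    by rewrite !mxE /sub_rel vH; case: (j \in H v); rewrite ?mul1r ?mul0r.
  have [jC|jC] := boolP (j \in C).
    by rewrite HC //; case: eqP; rewrite ?mulr0 // !mul0r.
  rewrite (_ : j != v) ?mulr1; last by apply: contraNneq jC => ->.
  have [jH|jH] := boolP (j \in H v); first by rewrite mul1r.
  by rewrite mul0r S0 //; apply: contra jH => /(near _ _ vC jC).
have [X XE] : {X : 'M[rat]_n | forall i, row i X = if i \in C then f i else 0}.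
  exists (\matrix_(i, j) (if i \in C then f i 0 j else 0)) => i.
  by apply/rowP=> j; rewrite !mxE; case: ifP => //; rewrite mxE.
have XP i : row i (X *m P) = if i \in C then row i (S *m D) else 0.
  rewrite row_mul XE; case: ifP => [iC|_]; last by rewrite mul0mx.
  by case: (fP i iC).
rewrite (@rank_congr _ S X (~: C)) // !coordmx_skew_mx ?setCK 1?addnC //; last first.
  rewrite -coordmx_skew_mx -/D -PD; apply/matrixP=> i j; rewrite [RHS]mxE.
  have -> : (X *m P *m X^T) i j = (row i (X *m P) *m (row j X)^T) 0 0.
    by rewrite [LHS]mxE [RHS]mxE; apply: eq_bigr => k _;
      rewrite ![_^T _ _]mxE [row _ _ _ _]mxE [row _ _ _ _]mxE.
  rewrite XP XE; have [iC|_] := boolP (i \in C); last by rewrite mul0mx mxE.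
  have [jC|_] := boolP (j \in C); last by rewrite trmx0 mulmx0 mxE.
  (* Diagonal entries of [X P X^T] vanish by skewness. Off the diagonal, the coupling row of [i] is
     supported in [H i] and [f j] in [H j], which are disjoint. *)
  have [<-|ij] := eqVneq i j.
    by case: (fP i iC) => <- _; rewrite (skew_form0 _ PT) mxE.
  rewrite mxE big1 // => k _; rewrite [row _ _ _ _]mxE mulmx_coordmxE [_^T _ _]mxE in_setC.
  have [kj|kj] := boolP (k \in H j); last first.
    by case: (fP j jC) => _ ->; rewrite ?mulr0 // inE negb_and kj orbT.
  have [kC|kC] := boolP (k \in C); first by rewrite mulr0 mul0r.
  rewrite S0 ?mul0r //; apply/negP=> /(near _ _ iC kC) ki.
  by move: (disjointFr (dis _ _ iC jC ij) ki); rewrite kj.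
rewrite -coordmx_skew_mx -/D -PD; apply/row_matrixP=> i; rewrite XP.
apply/rowP=> j; rewrite [LHS]mxE -mulmxA mul_coordmxE.
by case: (i \in C); rewrite !mxE ?mul1r ?mul0r.
Qed.

Lemma rank_even_cycle arc c : oriented arc -> is_cycle (adj arc) c -> ~~ odd (size c) ->
    {in c &, forall x y, adj arc x y -> cyc_edge c x y} ->
    ~ evenly_oriented arc c ->
  (size c <= \rank (skew_mx (sub_rel [set x in c] arc)))%N.
Proof.
move=> ori [uc sz_c cyc_c] ev_c chordless neven.
set C := [set x in c]; set S := skew_mx (sub_rel C arc).
(* A kernel vector changes by the factor [s y * s (next c y)] over two steps along the cycle; once
   around, it is multiplied by the sign of the cycle, so it vanishes when that sign is negative. *)
suff ker : (kermx S <= kermx (coordmx C))%MS.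
  have := mxrankS ker; rewrite !mxrank_ker rank_coordmx cardsE (card_uniqP uc).
  have szn : (size c <= n)%N by rewrite -(card_uniqP uc) -[n in (_ <= n)%N]card_ord max_card.
  by have := rank_leq_row S; rewrite leq_sub2lE // => *; lia.
apply/rV_subP=> x /sub_kermxP xS; apply/sub_kermxP; apply/rowP=> i.
rewrite mulmx_coordmxE mxE inE; case: (boolP (i \in c)) => ic; rewrite ?mulr0 // mulr1.
pose s y := skew_mx arc y (next c y).
have cyc := cycle_next uc.
have traj y : y \in c -> traject (next c) y (size c) = rot (index y c) c.
  by move=> yc; rewrite -{1}(order_cycle cyc uc yc) -/(orbit _ _) (orbitE cyc).
have step y : y \in c -> x 0 (next c (next c y)) = x 0 y * (s y * s (next c y)).
  move=> yc; set j := next c y; set z := next c j.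
  have jc : j \in c by rewrite mem_next.
  have zc : z \in c by rewrite mem_next.
  (* Length at least 3 is used here: [y], [j], [z] are the first three entries of a rotation of
     [c]. *)
  have yz : y != z.
    have := uc; rewrite -(rot_uniq (index y c)) -traj //.
    case: (size c) sz_c => [|[|[|k]]] //= _; rewrite !inE !negb_or -/j -/z.
    by case/andP=> /and3P[].
  have SE a : a \in c -> S a j = skew_mx arc a j.
    by move=> ac; rewrite !mxE /sub_rel !inE ac jc.
  have sq : s j * s j = 1.
    have := next_cycle cyc_c jc; rewrite /s mxE -/z /adj.
    by case: (arc j z); case: (arc z j); rewrite ?mulr1 ?mulrNN ?mulr1.
  (* Without chords, [y] and [z] are the only neighbours of [j] in [C], so this equation has just
     two terms. *)
  have : (x *m S) 0 j = 0 by rewrite xS mxE.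
  rewrite mxE (bigD1 y) //= (bigD1 z) 1?eq_sym //= big1 ?addr0; last first.
    move=> a /andP[ay az]; apply/eqP; rewrite mulf_eq0 skew_mx_eq0; apply/orP; right.
    apply/negP=> /orP H; have [ac aj] : a \in c /\ adj arc a j.
      by rewrite /adj; case: H => /and3P[]; rewrite !inE => ? ? ->; rewrite ?orbT.
    have /and4P[_ _ _ /orP[/eqP na|/eqP na]] := chordless _ _ ac jc aj.
      by case/negP: ay; apply/eqP/(can_inj (prev_next uc)).
    by rewrite -na eqxx in az.
  rewrite SE // SE // (_ : skew_mx arc z j = - s j); last first.
    have /matrixP/(_ j z) := tr_skew_mx ori; rewrite [LHS]mxE => ->.
    by rewrite [LHS]mxE.
  rewrite -/(s y) mulrN => /subr0_eq E.
  by rewrite mulrA E -mulrA sq mulr1.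
have steps m y : y \in c ->
    x 0 (iter m.*2 (next c) y) = x 0 y * \prod_(z <- traject (next c) y m.*2) s z.
  elim: m y => [|m IH] y yc; first by rewrite big_nil mulr1.
  rewrite doubleS !iterSr IH ?mem_next // step // !big_cons /=.
  by rewrite -!mulrA.
(* As the length is even, half as many double steps return to [i], giving [x i = x i * prod]. A
   nonzero [x i] makes the product 1, against [neven]. *)
have := steps (size c)./2 i ic; rewrite even_halfK //.
rewrite -{1}(order_cycle cyc uc ic) (iter_order_cycle cyc) // traj //.
rewrite (perm_big c) ?perm_rot //= => /eqP; rewrite -subr_eq0 -{1}[x 0 i]mulr1 -mulrBr.
rewrite mulf_eq0 => /orP[/eqP//|]; rewrite subr_eq0 => /eqP one.
by case: neven; rewrite /evenly_oriented -[X in 0 < X]one.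
Qed.
End Gluing.

(** * Cycles and stars *)

Section Structure.
Variable n : nat.
Implicit Types (A B : {set 'I_n}) (arc e : rel 'I_n) (c : seq 'I_n).

Lemma cyc_edge_sym c : symmetric (cyc_edge c).
Proof.
by move=> x y; rewrite /cyc_edge andbCA (eq_sym x) orbC.
Qed.

Lemma cyc_edge_next e c x : irreflexive e -> is_cycle e c -> x \in c ->
  cyc_edge c x (next c x).
Proof.
move=> irr [_ _ cyc] xc; rewrite /cyc_edge mem_next xc eqxx /= andbT.
by apply/eqP=> E; have := next_cycle cyc xc; rewrite -E irr.
Qed.

Lemma cyc_edge_adj e c x y : symmetric e -> is_cycle e c -> cyc_edge c x y -> e x y.
Proof.
move=> sym [_ _ cyc] /and4P[xc yc _ /orP[]/eqP<-]; first exact: next_cycle.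
by rewrite sym; apply: next_cycle.
Qed.

Definition del_edge e a b : rel 'I_n :=
  fun x y => e x y && ~~ ((x == a) && (y == b) || (x == b) && (y == a)).

Lemma del_edge_sym e a b : symmetric e -> symmetric (del_edge e a b).
Proof.
move=> sym x y; rewrite /del_edge sym; congr (_ && ~~ _).
by rewrite orbC; congr (_ || _); rewrite andbC.
Qed.

(** A simple path from [a] to [b] avoiding the edge [a b] closes up with it. The result has at least
    three vertices, since a one-edge path would be the deleted edge. *)
Lemma cycle_through_edge e a b : symmetric e -> a != b -> e a b ->
  connect (del_edge e a b) a b -> exists2 c, is_cycle e c & cyc_edge c a b.
Proof.
move=> sym ab eab /connectP[p0 pth0 lst0]; move: lst0 ab eab.
case: (shortenP pth0) => p pth up _ {pth0 p0} lst ab eab.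
have bp : b \in a :: p by rewrite lst mem_last.
have pe : path e a p by apply: sub_path pth => x y /andP[].
exists (a :: p).
  split=> //; last by rewrite /= rcons_path pe -lst sym.
  case: p {up bp pe} pth lst => [|x [|y p]] //=.
    by move=> _ E; rewrite E eqxx in ab.
  by case/andP=> /andP[_ /negP nb] _ E; case: nb; rewrite E !eqxx.
apply/and4P; split=> //; first exact: mem_head.
(* [b] is the last entry of the list, so its successor wraps around to [a], obtained as the default
   value of [nth]. *)
apply/orP; right.
by rewrite next_nth bp lst index_last // nth_default.
Qed.

Lemma acyclic_triangle A e x y z : symmetric e -> irreflexive e -> acyclic (sub_rel A e) ->
  x \in A -> y \in A -> z \in A -> e x y -> e y z -> e x z -> False.
Proof.
move=> sym irr acyc xA yA zA exy eyz exz; apply: (acyc [:: x; y; z]).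
have ne a b : e a b -> (a == b) = false.
  by move=> eab; apply/eqP=> E; rewrite E irr in eab.
split=> //=; last by rewrite /sub_rel xA yA zA exy eyz sym exz.
by rewrite !inE (ne _ _ exy) (ne _ _ eyz) (ne _ _ exz).
Qed.

Lemma matching_number_two A e a b a' b' : a \in A -> b \in A -> e a b ->
    a' \in A -> b' \in A -> e a' b' -> a' != a -> a' != b -> b' != a -> b' != b ->
  1 < matching_number A e.
Proof.
move=> aA bA eab a'A b'A eab' h1 h2 h3 h4.
have sAB : [set a; b] :|: [set a'; b'] \subset A.
  by rewrite !subUset !sub1set aA bA a'A b'A.
apply: leq_trans (leq_matching_number e sAB).
apply: leq_trans (matching_numberU e _); last first.
  rewrite disjoint_subset; apply/subsetP=> t; rewrite !inE => /orP[]/eqP->.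
    by rewrite (eq_sym a) (negPf h1) (eq_sym a) (negPf h3).
  by rewrite (eq_sym b) (negPf h2) (eq_sym b) (negPf h4).
rewrite -[2]/(1 + 1) leq_add //.
  by apply: (@matching_edge _ _ _ a b); rewrite ?set21 ?set22.
by apply: (@matching_edge _ _ _ a' b'); rewrite ?set21 ?set22.
Qed.

(** Any two edges meet. Fix an edge [x y]: if some edge avoids [x], it is [y b] with [b != x], and
    then an edge avoiding [y] must be [x b], which closes a triangle. So [x] or [y] lies on every
    edge. *)
Lemma matching_number_star A e : symmetric e -> irreflexive e -> acyclic (sub_rel A e) ->
    matching_number A e = 1 -> (forall x, x \in A -> exists2 y, y \in A & e x y) ->
  is_star A e.
Proof.
move=> sym irr acyc m1 niso.
have [|x [y [xA yA exy]]] := @matching_number_gt0 _ A e; first by rewrite m1.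
have meet a b a' b' : a \in A -> b \in A -> e a b -> a' \in A -> b' \in A -> e a' b' ->
    [|| a' == a, a' == b, b' == a | b' == b].
  move=> aA bA eab a'A b'A eab'; apply/negPn/negP; rewrite !negb_or => /and4P[h1 h2 h3 h4].
  by have := matching_number_two aA bA eab a'A b'A eab' h1 h2 h3 h4; rewrite m1.
suff [z zA zP] : exists2 z, z \in A &
    forall p q, p \in A -> q \in A -> e p q -> (p == z) || (q == z).
  exists z => //; split=> // p pA pz; have [q qA epq] := niso p pA.
  by have := zP p q pA qA epq; rewrite (negPf pz) /= => /eqP<-; rewrite sym.
have [/forall_inP xP|] :=
    boolP [forall p in A, forall q in A, e p q ==> ((p == x) || (q == x))].
  exists x => // p q pA qA; have /forall_inP/(_ q qA)/implyP H := xP p pA; exact: H.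
case/forall_inPn=> p pA /forall_inPn[q qA]; rewrite negb_imply negb_or => /and3P[epq px qx].
have [b bA] : exists2 b, b \in A & e y b && (b != x).
  have := meet _ _ _ _ xA yA exy pA qA epq; rewrite (negPf px) (negPf qx) /=.
  by case/orP=> /eqP E; [exists q | exists p] => //; rewrite -E ?epq // sym epq.
case/andP=> eyb bx; exists y => // r t rA tA ert.
apply/negPn/negP; rewrite negb_or => /andP[ry ty].
suff H : forall t, t \in A -> e x t -> t != y -> False.
  have := meet _ _ _ _ xA yA exy rA tA ert; rewrite (negPf ry) (negPf ty) orbF /=.
  case/orP=> /eqP E; first by apply: (H t) => //; rewrite -E.
  by apply: (H r) => //; rewrite -E sym.
move=> {r t rA tA ert ry ty} t tA ext ty.
have xy : x != y by apply/eqP=> E; rewrite E irr in exy.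
have := meet _ _ _ _ yA bA eyb xA tA ext.
rewrite (negPf xy) (negPf ty) (eq_sym x) (negPf bx) /= => /eqP E.
by apply: (acyclic_triangle sym irr acyc xA yA bA exy eyb); rewrite -E.
Qed.

(** The isomorphism is the position in the list [L]: the cycle rotated to start at [v] (positions
    below [size c]), then the star centre [z] at position [size c], then the leaves. *)
Lemma ustar_of_adj arc c v z : uniq c -> v \in c -> z \notin c ->
    {in c &, forall x y, adj arc x y = (next c x == y) || (next c y == x)} ->
    (forall x y, x \in c -> y \notin c -> adj arc x y = (x == v) && (y == z)) ->
    (forall x y, x \notin c -> y \notin c ->
       adj arc x y = (x == z) && (y != z) || (y == z) && (x != z)) ->
  isomorphic_to_ustar arc (size c).
Proof.
move=> uc vc zc adj_in adj_mid adj_out.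
pose s0 := rot (index v c) c.
pose r := [seq x <- enum 'I_n | (x \notin c) && (x != z)].
pose L := s0 ++ z :: r.
have memL x : x \in L.
  rewrite mem_cat mem_rot inE mem_filter mem_enum /=.
  by case: (x \in c); case: (x == z).
have uL : uniq L.
  rewrite cat_uniq rot_uniq uc cons_uniq filter_uniq ?enum_uniq // mem_filter eqxx andbF /= !andbT.
  rewrite mem_rot negb_or zc /=; apply/hasPn=> x; rewrite mem_filter mem_rot => /andP[/andP[]].
  by [].
have szL : size L = n.
  by rewrite -(card_uniqP uL) -[RHS]card_ord; apply: eq_card => x; rewrite memL.
have lt x : index x L < n by rewrite -[X in _ < X]szL index_mem.
pose f x := Ordinal (lt x).
have f_inj : injective f.
  move=> x y /(congr1 val) /= E; rewrite -[x](nth_index x (memL x)) E.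
  by rewrite nth_index.
exists f; split; first exact: injF_bij.
have k0 : 0 < size c by case: (c) vc.
have sz0 : size s0 = size c by rewrite size_rot.
have fE x : index x L = if x \in c then index x s0 else
    if x == z then size c else (size c + (index x r).+1).
  rewrite index_cat mem_rot sz0; case: (x \in c) => //=.
  by rewrite eq_sym; case: (x == z); rewrite ?addn0.
have lts x : x \in c -> index x s0 < size c by move=> xc; rewrite -sz0 index_mem mem_rot.
have nx x y : x \in c -> y \in c ->
    (next c x == y) = (index y s0 == (index x s0).+1 %% size c).
  move=> xc yc; have xs : x \in s0 by rewrite mem_rot.
  have ys : y \in s0 by rewrite mem_rot.
  have us : uniq s0 by rewrite rot_uniq.
  (* At the last position, [next] wraps to the head [v] through the default of [nth], which agrees
     with index 0 modulo [size c]. *)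
  have -> : next c x = nth v s0 ((index x s0).+1 %% size c).
    rewrite -(next_rot (index v c) uc) next_nth -/s0 xs.
    have := lts x xc; rewrite -sz0; set i := index x s0; clearbody i.
    rewrite /s0 rot_index //=; set q := _ ++ _; rewrite ltnS leq_eqVlt => /orP[/eqP->|lt_i].
      by rewrite modnn nth_default.
    by rewrite modn_small.
  rewrite -{1}(nth_index v ys) nth_uniq ?sz0 ?lts ?ltn_pmod // eq_sym //.
have v0 x : x \in c -> (index x s0 == 0) = (x == v).
  by move=> xc; rewrite /s0 rot_index //= [x == v]eq_sym; case: (v == x).
have big m : ((size c + m.+1 < size c) = false) * ((size c + m.+1 == size c) = false) *
    (size c < size c + m.+1) * ((size c + m.+1 == 0) = false).
  by split; [split; [split|]|]; lia.
have c0 : (size c == 0) = false by rewrite gtn_eqF.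
have nlt m : m < size c -> (size c < m) = false by move=> lt_m; rewrite ltnNge ltnW.
move=> x y; rewrite /ustar_adj /= !fE.
have [xc|xc] := boolP (x \in c); have [yc|yc] := boolP (y \in c).
- rewrite adj_in // !lts //= !nx //.
  have := lts x xc; have := lts y yc => hy hx.
  rewrite (ltn_eqF hx) (ltn_eqF hy) !andbF /= !orbF.
  by [].
- rewrite adj_mid // lts //= v0 // (ltn_eqF (lts x xc)) /=.
  rewrite (nlt _ (lts x xc)) andbF orbF.
  by case: (y == z); rewrite ?eqxx ?ltnn ?big ?andbT ?andbF /=.
- rewrite adj_sym adj_mid // lts //= v0 // (ltn_eqF (lts y yc)) /=.
  rewrite (nlt _ (lts y yc)) !andbF orbF /=.
  by case: (x == z); rewrite ?eqxx ?ltnn ?big ?andbT ?andbF /= ?orbF.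
- rewrite adj_out //.
  by case: (x == z); case: (y == z); rewrite /= ?eqxx ?ltnn ?big ?c0 ?andbT ?andbF ?orbF.
Qed.

End Structure.

(** * Unicyclic graphs *)

Section Unicyclic.
Variables (n : nat) (arc : rel 'I_n) (c : seq 'I_n).
Hypotheses (ori : oriented arc) (uni : unicyclic_with_cycle arc c).
Local Notation H := (hang arc c).
Local Notation C := [set x in c].
Local Notation mu A := (matching_number A (adj arc)).

Let sym := adj_sym arc.
Let irr : irreflexive (adj arc) := adj_irr ori.
Let cyc : is_cycle (adj arc) c. Proof. by case: uni. Qed.
Let uc : uniq c. Proof. by case: cyc. Qed.

Lemma adj_nocyc_sym : symmetric (adj_nocyc arc c).
Proof. by move=> x y; rewrite /adj_nocyc sym cyc_edge_sym. Qed.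

Lemma hang_refl v : v \in H v.
Proof. by rewrite inE connect0. Qed.

(** An edge that is not a bridge lies on a cycle, and by uniqueness every cycle has the edges of
    [c]. *)
Lemma cyc_edge_of_connect a b : adj arc a b -> connect (del_edge (adj arc) a b) a b ->
  cyc_edge c a b.
Proof.
move=> eab con; have ab : a != b by apply/eqP=> E; rewrite E irr in eab.
have [c' cyc' abc'] := cycle_through_edge sym ab eab con.
by case: uni => _ _ /(_ c' cyc') <-.
Qed.

(** A path outside the cycle joining two cycle vertices would close up, through the cycle, into
    a second cycle containing its first edge. *)
Lemma hang_cycle v x : v \in c -> x \in c -> (x \in H v) = (x == v).
Proof.
move=> vc xc; apply/idP/eqP=> [|->]; last exact: hang_refl.
rewrite inE => /connectP[p0 pth0 lst0]; move: lst0; case: (shortenP pth0).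
move=> [|b p] /= pth up _ lst //; case/andP: pth => /andP[evb nvb] pth.
case/negP: (nvb); apply: cyc_edge_of_connect => //.
have via_cycle : connect (del_edge (adj arc) v b) v x.
  apply: (connect_cycle (p := c)) => //.
  apply: (sub_in_cycle (P := mem c)) (cycle_next uc); last exact/allP.
  move=> y w yc _ /eqP <-; have yn := cyc_edge_next irr cyc yc.
  rewrite /del_edge (cyc_edge_adj sym cyc yn) /=; apply/negP=> /orP[]/andP[/eqP E1 /eqP E2].
    by move: yn; rewrite E1 in E2 *; rewrite E2 (negPf nvb).
  by move: yn; rewrite E1 in E2 *; rewrite E2 cyc_edge_sym (negPf nvb).
(* The remaining path from [b] to [x] never returns to [v], so it avoids the edge [v b] as well;
   reversed, it completes the connection. *)
apply: connect_trans via_cycle _; rewrite sym_connect_sym; last exact: del_edge_sym.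
apply/connectP; exists p => //.
move: up => /andP[vbp _]; apply: (sub_in_path (P := predC1 v)) pth.
  move=> y w /negPf yv /negPf wv /andP[eyw _].
  by rewrite /del_edge eyw yv wv andbF.
by apply/allP=> y yp; apply: contraNneq vbp => <-.
Qed.

Lemma hang_trans v x y : x \in H v -> adj_nocyc arc c x y -> y \in H v.
Proof. by rewrite !inE => vx xy; apply: connect_trans vx (connect1 xy). Qed.

Lemma hang_adj v x y : x \in H v -> adj arc x y -> ~~ cyc_edge c x y -> y \in H v.
Proof. by move=> xv xy nxy; apply: hang_trans xv _; rewrite /adj_nocyc xy. Qed.

Lemma hang_disjoint v w : v \in c -> w \in c -> v != w -> [disjoint H v & H w].
Proof.
move=> vc wc vw; rewrite disjoint_subset; apply/subsetP=> x; rewrite !inE => vx.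
apply: contra vw => wx; rewrite eq_sym -(hang_cycle vc wc) inE.
by apply: connect_trans vx _; rewrite sym_connect_sym //; apply: adj_nocyc_sym.
Qed.

(** Along a walk from a cycle vertex to [x], a cycle edge passes to the tree of its endpoint and any
    other edge stays in the current tree. *)
Lemma hang_cover x : exists2 v, v \in c & x \in H v.
Proof.
case: uni => con [_ sz _] _.
have [v0 v0c] : exists v, v \in c by case: (c) sz => [|v s] // _; exists v; rewrite mem_head.
have /connectP[p pth ->] := con v0 x.
have : exists2 v, v \in c & v0 \in H v by exists v0; rewrite ?hang_refl.
elim: p v0 {v0c} pth => //= y p IH x0 /andP[exy pth] [v vc xv]; apply: IH pth _.
have [/and4P[_ yc _ _]|nxy] := boolP (cyc_edge c x0 y).
  by exists y; rewrite ?hang_refl.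
by exists v => //; apply: hang_adj exy nxy.
Qed.

Lemma hang_chordless v x y : v \in c -> x \in H v -> y \in H v -> adj arc x y ->
  ~~ cyc_edge c x y.
Proof.
move=> vc xv yv exy; apply/negP=> /and4P[xc yc xy _]; case/negP: xy.
by rewrite hang_cycle // in xv; rewrite hang_cycle // in yv; rewrite (eqP xv) (eqP yv).
Qed.

Lemma adj_nocyc_hang v : v \in c -> {in H v &, adj_nocyc arc c =2 adj arc}.
Proof.
move=> vc x y xv yv; rewrite /adj_nocyc; case: (boolP (adj arc x y)) => //= exy.
exact: (hang_chordless vc xv yv).
Qed.

(** A chord [x y] would put the cycle vertex [y] into the tree hanging at [x], forcing [y = x]. *)
Lemma cycle_chordless : {in c &, forall x y, adj arc x y -> cyc_edge c x y}.
Proof.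
move=> x y xc yc exy; apply: contraLR (exy) => nxy; apply/negP=> _.
have := hang_adj (hang_refl x) exy nxy; rewrite hang_cycle // => /eqP E.
by rewrite E irr in exy.
Qed.

(** Every cycle has the same edges as [c], hence passes through [v]. *)
Lemma acyclic_missing (A : {set 'I_n}) v : v \in c -> v \notin A -> acyclic (sub_rel A (adj arc)).
Proof.
move=> vc vA c' cyc'; case: uni => _ _ /(_ c').
have ca : is_cycle (adj arc) c' by apply: sub_is_cycle cyc' => x y /and3P[].
move/(_ ca v (next c v)); rewrite (cyc_edge_next irr cyc vc) => /and4P[vc' _ _ _].
case: cyc' => _ _ cyc'; have /and3P[] := next_cycle cyc' vc'.
by rewrite (negPf vA).
Qed.

Lemma acyclic_hang v : v \in c -> acyclic (sub_rel (H v) (adj arc)).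
Proof.
move=> vc; apply: (@acyclic_missing _ (next c v)); rewrite ?mem_next //.
rewrite hang_cycle ?mem_next //; have /and4P[_ _] := cyc_edge_next irr cyc vc.
by rewrite eq_sym.
Qed.

Lemma rank_missing (A : {set 'I_n}) v : v \in c -> v \notin A ->
  \rank (skew_mx (sub_rel A arc)) = (mu A).*2.
Proof. by move=> vc vA; apply: rank_forest => //; apply: acyclic_missing vc vA. Qed.

Lemma rank_hang v : v \in c -> \rank (skew_mx (sub_rel (H v) arc)) = (mu (H v)).*2.
Proof. by move=> vc; apply: rank_forest => //; apply: acyclic_hang. Qed.

Lemma hang_no_isolated v x y : v \in c -> x \in H v -> y \in H v -> x != y ->
  exists2 z, z \in H v & adj arc x z.
Proof.
move=> vc xv yv xy.
have : connect (adj_nocyc arc c) x y.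
  rewrite !inE in xv yv; apply: connect_trans yv.
  by rewrite sym_connect_sym //; apply: adj_nocyc_sym.
case/connectP=> [[|z p]] /= => [_ E|/andP[exz _] _]; first by rewrite E eqxx in xy.
by exists z; [apply: hang_trans exz | case/andP: exz].
Qed.

Lemma hang_star v : v \in c -> mu (H v) = 1 -> is_star (H v) (adj arc).
Proof.
move=> vc m1; apply: matching_number_star => //; first exact: acyclic_hang.
have [|a [b [aH bH eab]]] := @matching_number_gt0 _ (H v) (adj arc); first by rewrite m1.
move=> x xH; have ab : a != b by apply/eqP=> E; rewrite E irr in eab.
have [E|xa] := eqVneq x a; last exact: (hang_no_isolated vc xH aH xa).
by exists b; rewrite ?E.
Qed.

(** Deleting [v] leaves a path on [(size c).-1] vertices. *)
Lemma matching_cycle_del v : v \in c -> (size c).-1./2 <= mu (C :\ v).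
Proof.
move=> vc; case: cyc => _ sz cc; have [i p def_c] := rot_to vc.
have := uc; rewrite -(rot_uniq i) def_c => up.
move: cc; rewrite -(rot_cycle i) def_c.
have memp x : (x \in c) = (x \in v :: p) by rewrite -def_c mem_rot.
rewrite -(size_rot i) def_c /= in sz *.
case: p def_c up memp sz => [|x p] // def_c up memp sz /=.
rewrite rcons_path => /and3P[_ pth _].
have -> : C :\ v = [set z in x :: p].
  apply/setP=> z; rewrite !inE memp !inE; case: eqP => //= ->.
  by move: up; rewrite cons_uniq inE => /andP[/negPf->].
by apply: matching_path => //; case/andP: up.
Qed.

Lemma saturated_hang v : v \in c -> saturated (H v) (adj_nocyc arc c) v ->
  mu (H v :\ v) < mu (H v).
Proof.
move=> vc /saturated_gt; rewrite (eq_matching_number (adj_nocyc_hang vc)).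
rewrite (@eq_matching_number _ _ _ (adj arc)) // => x y.
by move=> /setD1P[_ xv] /setD1P[_ yv]; apply: (adj_nocyc_hang vc).
Qed.

Lemma unsaturated_hang v : v \in c -> ~ saturated (H v) (adj_nocyc arc c) v ->
  mu (H v) <= mu (H v :\ v).
Proof.
move=> vc /unsaturated_leq; rewrite (eq_matching_number (adj_nocyc_hang vc)).
rewrite (@eq_matching_number _ _ _ (adj arc)) // => x y.
by move=> /setD1P[_ xv] /setD1P[_ yv]; apply: (adj_nocyc_hang vc).
Qed.

(** Both sides of the cut at [v] miss a cycle vertex, so they are forests and their ranks are twice
    their matching numbers; saturation supplies the rank drop. *)
Lemma skew_rank_saturated v : v \in c -> saturated (H v) (adj_nocyc arc c) v ->
  skew_rank arc = (mu (H v)).*2 + (mu (~: H v)).*2.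
Proof.
move=> vc sat; rewrite /skew_rank (@rank_cut_vertex _ arc (H v) v) ?hang_refl //.
- by rewrite rank_hang // (@rank_missing (~: H v) v) // in_setC hang_refl.
- move=> x y xv yv exy; have [/and4P[xc _ _ _]|nxy] := boolP (cyc_edge c x y).
    by apply/eqP; rewrite -hang_cycle.
  by rewrite (hang_adj xv exy nxy) in yv.
rewrite rank_hang // (@rank_missing _ v) ?setD11 // ltn_double.
exact: saturated_hang.
Qed.

Lemma saturated_case v : v \in c -> saturated (H v) (adj_nocyc arc c) v ->
    skew_rank arc = (if odd (size c) then (size c).+1 else size c) ->
  is_star (H v) (adj_nocyc arc c) /\
  mu (~: H v) = (if odd (size c) then (size c - 1) %/ 2 else (size c - 2) %/ 2).
Proof.
move=> vc sat rk; have rk' := skew_rank_saturated vc sat.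
have pos : 0 < mu (H v) := leq_ltn_trans (leq0n _) (saturated_hang vc sat).
have sub : C :\ v \subset ~: H v.
  apply/subsetP=> x; rewrite !inE => /andP[xv xc]; apply: contra xv => xv.
  by rewrite -hang_cycle // inE.
have low := leq_trans (matching_cycle_del vc) (leq_matching_number (adj arc) sub).
have sz : 2 < size c by case: cyc.
(* The two matching numbers add up to [k/2] or [(k+1)/2], which equals the sum of the lower bounds 1
   and [(k-1)/2] rounded down; both bounds are therefore attained. *)
have [m1 m2] : mu (H v) = 1 /\
    mu (~: H v) = (if odd (size c) then (size c - 1) %/ 2 else (size c - 2) %/ 2).
  by rewrite rk in rk'; move: rk' low pos sz; case: ifP; lia.
split=> //; have [z zH [z1 z2]] := hang_star vc m1; exists z => //; split.
  by move=> x xH xz; rewrite (adj_nocyc_hang vc) // z1.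
by move=> x y xH yH; rewrite (adj_nocyc_hang vc) //; apply: z2.
Qed.

Lemma unsaturated_case : size c < n ->
    skew_rank arc = (if odd (size c) then (size c).+1 else size c) ->
    (forall v, v \in c -> ~ saturated (H v) (adj_nocyc arc c) v) ->
  isomorphic_to_ustar arc (size c) /\ (~~ odd (size c) -> evenly_oriented arc c).
Proof.
move=> ltn rk unsat.
have le_mu v : v \in c -> mu (H v) <= mu (H v :\ v).
  by move=> vc; apply: unsaturated_hang vc (unsat v vc).
have szc : 2 < size c by case: cyc.
have HC v x : v \in c -> x \in H v :\ v -> x \notin c.
  by move=> vc /setD1P[xv xH]; apply: contra xv => xc; rewrite -hang_cycle.
have HsubC v : v \in c -> H v :\ v \subset ~: C.
  by move=> vc; apply/subsetP=> x /(HC _ _ vc); rewrite !inE.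
have Hpos v x : v \in c -> x \in H v -> x != v -> 0 < mu (H v :\ v).
  move=> vc xH xv; apply: leq_trans (le_mu v vc).
  by have [z zH exz] := hang_no_isolated vc xH (hang_refl v) xv; apply: matching_edge exz.
have rkC : skew_rank arc = \rank (skew_mx (sub_rel C arc)) + (mu (~: C)).*2.
  have [v0 v0c] : exists v, v \in c by case: (c) szc => [|v s] // _; exists v; rewrite mem_head.
  rewrite -(@rank_missing _ v0) ?in_setC ?inE ?v0c //.
  apply: (@rank_attached _ arc C H) => //.
  - move=> v x; rewrite !inE => vc xc evx; rewrite -inE -/(H v) (hang_adj (hang_refl v) evx) //.
    by rewrite /cyc_edge (negPf xc) andbF.
  - by move=> v w; rewrite !inE; apply: hang_disjoint.
  - move=> v x y; rewrite 1!inE => vc xH yH; rewrite !inE => xc yc; apply: contra yH => exy.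
    by apply: hang_adj exy _ => //; rewrite /cyc_edge (negPf xc).
  - by move=> v x; rewrite !in_set => vc xc; rewrite -hang_cycle // inE.
  move=> v; rewrite inE => vc; rewrite rank_hang // (@rank_missing _ v) ?setD11 //.
  by rewrite leq_double le_mu.
(* [size c < n] gives a vertex off the cycle. Its tree is nontrivial, and as its root is unsaturated
   there is a matching edge avoiding the root. *)
have [x0 x0c] : exists x, x \notin c.
  apply/existsP; rewrite -negb_forall; apply/negP=> /forallP all_c.
  move: ltn; rewrite -(card_uniqP uc) -[X in _ < X]card_ord ltnNge; case/negP.
  by apply: subset_leq_card; apply/subsetP=> x _; apply: all_c.
have [v vc x0v] := hang_cover x0.
have x0v' : x0 != v by apply: contraNneq x0c => ->.
have pos := Hpos v x0 vc x0v x0v'.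
have le_v : mu (H v :\ v) <= mu (~: C) := leq_matching_number (adj arc) (HsubC v vc).
have low : (size c).-1./2.*2 <= \rank (skew_mx (sub_rel C arc)).
  apply: leq_trans (leq_rank_sub arc (subD1set C v)).
  by rewrite (@rank_missing _ v) ?setD11 // leq_double matching_cycle_del.
rewrite rkC in rk.
(* The cycle has rank at least [k-2] for even [k] and [k-1] for odd [k], leaving at most 2 for the
   complement, whose matching number is positive. *)
have mC : mu (~: C) = 1 by move: rk low le_v pos szc; case: ifP; lia.
split; last first.
  (* An even cycle that is not evenly-oriented has rank at least [k], and the tree edge adds 2,
     exceeding the assumed rank [k]. *)
  move=> ev; apply/negPn/negP=> /negP nev.
  have := rank_even_cycle ori cyc ev cycle_chordless nev.
  by move: rk; rewrite mC (negPf ev); lia.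
have mv : mu (H v) = 1.
  apply/eqP; rewrite eqn_leq (leq_trans (le_mu v vc)) ?(leq_trans le_v) ?mC //=.
  by apply: leq_trans pos _; apply: leq_matching_number (subD1set _ _).
have [z zH [z1 z2]] := hang_star vc mv.
(* Some edge of the tree avoids [v], and every edge contains the star centre [z]. *)
have zv : z != v.
  have [a [b [/setD1P[av aH] /setD1P[bv bH] eab]]] := matching_number_gt0 pos.
  by case/orP: (z2 a b aH bH eab) => /eqP<-.
have zc : z \notin c by apply: (HC v) => //; apply/setD1P.
(* A second nontrivial tree would contribute a disjoint edge off the cycle, against matching number
   1 there. *)
have single w x : w \in c -> x \in H w -> w != v -> x = w.
  move=> wc xw wv; apply/eqP/negPn/negP=> xw'.
  have pw := Hpos w x wc xw xw'.
  have sub : (H v :\ v) :|: (H w :\ w) \subset ~: C by rewrite subUset !HsubC.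
  have le1 := leq_matching_number (adj arc) sub; rewrite mC in le1.
  have dis : [disjoint H v :\ v & H w :\ w].
    rewrite eq_sym in wv.
    apply: disjointWl (subD1set _ _) _; apply: disjointWr (subD1set _ _) _.
    exact: hang_disjoint.
  by have := leq_trans (leq_trans (leq_add pos pw) (matching_numberU (adj arc) dis)) le1.
have outH x : x \notin c -> x \in H v.
  move=> xc; have [w wc xw] := hang_cover x.
  have [<-//|wv] := eqVneq w v.
  by rewrite (single w x wc xw wv) wc in xc.
apply: (@ustar_of_adj _ arc c v z) => //.
- move=> x y xc yc; apply/idP/idP=> [exy|exy].
    by have /and4P[] := cycle_chordless xc yc exy.
  apply: (cyc_edge_adj sym cyc); rewrite /cyc_edge xc yc exy andbT /=.
  apply/eqP=> E; move: exy; rewrite E orbb => /eqP E'.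
  by have /and4P[_ _] := cyc_edge_next irr cyc yc; rewrite E' eqxx.
- move=> x y xc yc; apply/idP/andP=> [exy|[/eqP-> /eqP->]]; last first.
    by rewrite sym z1 // ?hang_refl // eq_sym.
  have yx : y \in H x.
    by apply: hang_adj (hang_refl x) exy _; rewrite /cyc_edge (negPf yc) andbF.
  have xv : x = v.
    by apply/eqP/negPn/negP=> xv; rewrite (single x y xc yx xv) xc in yc.
  subst x; split=> //; have := z2 v y (hang_refl v) yx exy.
  by rewrite eq_sym (negPf zv).
move=> x y xc yc; have xH := outH x xc; have yH := outH y yc.
apply/idP/orP=> [exy|[]/andP[/eqP-> ne]]; last 2 first.
- exact: z1.
- by rewrite sym z1.
have xy : x != y by apply/eqP=> E; rewrite E irr in exy.
case/orP: (z2 x y xH yH exy) => /eqP E; [left|right]; rewrite E eqxx -E //=.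
by rewrite eq_sym.
Qed.

End Unicyclic.

Theorem theorem4p6 (n : nat) (arc : rel 'I_n) (c : seq 'I_n) :
  oriented arc ->
  unicyclic_with_cycle arc c ->
  skew_rank arc = (if odd (size c) then (size c).+1 else size c) ->
  (forall v, v \in c -> saturated (hang arc c v) (adj_nocyc arc c) v ->
     is_star (hang arc c v) (adj_nocyc arc c) /\
     matching_number (~: hang arc c v) (adj arc)
       = (if odd (size c) then (size c - 1) %/ 2 else (size c - 2) %/ 2))
  /\
  (size c < n ->
   (forall v, v \in c -> ~ saturated (hang arc c v) (adj_nocyc arc c) v) ->
     (odd (size c) -> isomorphic_to_ustar arc (size c)) /\
     (~~ odd (size c) -> isomorphic_to_ustar arc (size c) /\ evenly_oriented arc c)).
Proof.
move=> ori uni rk; split=> [v vc sat|ltn unsat]; first exact: saturated_case.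
have [iso even] := unsaturated_case ori uni ltn rk unsat.
by split=> // /even.
Qed.
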